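(* Let $C\subset\mathbb{P}^2_{\mathbb{Q}}$ be a smooth plane conic with $C(\mathbb{Q})\neq\emptyset$. For $i,j\in\{1,2,3\}$ let $c_{i,j}$ denote the number of common irreducible components (counted without multiplicity) of the divisors $x_i=0$ and $x_j=0$ on $C$, and suppose that the $3\times 3$ matrix with $(i,j)$-entry $c_{i,j}/\sqrt{c_{i,i}c_{j,j}}$ is singular. Then, up to permuting coordinates, the conic $C$ has the equation $x_1x_2=cx_3^2$ for some $c\in\mathbb{Q}$.
   Context: $x_1,x_2,x_3$ are the homogeneous coordinates on $\mathbb{P}^2_{\mathbb{Q}}$. Irreducible components are taken over $\mathbb{Q}$ (i.e. they are closed points of the $\mathbb{Q}$-scheme $C$). *)

(* Defs.v *)
From HB Require Import structures.
From mathcomp Require Import all_boot all_order all_algebra perm ring_quotient algC.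
From mathcomp Require Import boolp classical_sets cardinality reals.
From mathcomp Require Import finmap mpoly.

Set Implicit Arguments.
Unset Strict Implicit.
Unset Printing Implicit Defensive.

Import GRing.Theory Num.Theory.
Local Open Scope ring_scope.
Local Open Scope classical_set_scope.

(* The coordinates x_1, x_2, x_3 of P^2 over the rationals are 'X_0, 'X_1, 'X_2. *)

Definition homogeneous_ideal (I : set {mpoly rat[3]}) : Prop :=
  idealr_closed (mem I) /\
  forall f d, f \in I -> pihomog mdeg d f \in I.

(* The points of the scheme P^2 = Proj Q[x_1, x_2, x_3]: homogeneous primes
   not containing the irrelevant ideal (properness is part of idealr_closed). *)
Definition proj_point (p : set {mpoly rat[3]}) : Prop :=
  [/\ homogeneous_ideal p, prime_idealr_closed (mem p)
    & exists i : 'I_3, 'X_i \notin p].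

Definition plane_conic (q : {mpoly rat[3]}) : Prop :=
  q != 0 /\ q \is 2.-homog.

(* Smoothness over Q, by the Jacobian criterion at the geometric points. *)
Definition smooth_curve (q : {mpoly rat[3]}) : Prop :=
  forall P : 'I_3 -> algC, (exists i, P i != 0) ->
    (map_mpoly ratr q).@[P] = 0 ->
    exists i, (map_mpoly ratr (mderiv i q)).@[P] != 0.

Definition has_rational_point (q : {mpoly rat[3]}) : Prop :=
  exists P : 'I_3 -> rat, (exists i, P i != 0) /\ q.@[P] = 0.

(* The points of the scheme {q = 0} that lie on the coordinate line x_i = 0. *)
Definition divisor_points (q : {mpoly rat[3]}) (i : 'I_3) :
    set (set {mpoly rat[3]}) :=
  [set p | [/\ proj_point p, q \in p & 'X_i \in p]].

(* Irreducible components over Q of the divisor x_i = 0 on {q = 0}, each given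
   by its generic point, i.e. by an inclusion-minimal homogeneous prime. When
   x_i does not vanish identically on the curve, these are closed points. *)
Definition divisor_components (q : {mpoly rat[3]}) (i : 'I_3) :
    set (set {mpoly rat[3]}) :=
  [set p | divisor_points q i p /\
    forall p', divisor_points q i p' -> p' `<=` p -> p' = p].

(* fset_set is the empty fset on infinite sets; the set below is finite for a
   smooth conic. *)
Definition common_components (q : {mpoly rat[3]}) (i j : 'I_3) : nat :=
  #|` fset_set (divisor_components q i `&` divisor_components q j) |.

Definition component_matrix (R : realType) (q : {mpoly rat[3]}) : 'M[R]_3 :=
  \matrix_(i, j) ((common_components q i j)%:R /
    Num.sqrt ((common_components q i i)%:R * (common_components q j j)%:R)).

(* The curves {q = 0} and {f = 0} are the same subscheme of P^2 (for forms q and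
   f of the same degree). *)
Definition has_equation (q f : {mpoly rat[3]}) : Prop :=
  exists2 a : rat, a != 0 & q = a *: f.

(* Main.v *)
(* Write the conic as [q = \sum_(i <= j) a_ij x_i x_j].  The lines [x_i = 0] and
   [x_j = 0] meet only in the vertex [e_k], so [c_ij <= 1], with [c_ij = 1] only
   if [a_kk = 0].  If [e_k] lies on the conic and [x_i = 0] is not tangent there,
   then [x_i = 0] meets the conic in a second rational point and [c_ii >= 2];
   smoothness forbids that both [x_i = 0] and [x_j = 0] are tangent at [e_k].
   Clearing the square roots, the determinant is an integer expression in the
   [c_ij], and under these constraints it vanishes only if, for some [i],
   [c_ij = c_ik = 1], [c_jk = 0] and [c_jj = c_kk = 1].  The lines [x_j = 0] and
   [x_k = 0] are then tangent to the conic at [e_k] and [e_j], which kills all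
   coefficients except [a_ii] and [a_jk]. *)
From HB Require Import structures.
Require Import Defs.
From mathcomp Require Import all_boot all_order all_algebra perm ring_quotient algC.
From mathcomp Require Import boolp classical_sets cardinality reals finmap mpoly.
From mathcomp Require Import ring zify.

Set Implicit Arguments.
Unset Strict Implicit.
Unset Printing Implicit Defensive.

Import Order.TTheory GRing.Theory Num.Theory.
Local Open Scope ring_scope.

(** * Arithmetic of homogeneous primes *)

Lemma proj_point_add p f g : proj_point p -> p f -> p g -> p (f + g).
Proof.
case=> [[[_ _ h] _] _ _] pf pg; apply: set_mem.
by move: (h 1 f g (mem_set pf) (mem_set pg)); rewrite mul1r.
Qed.

Lemma proj_point0 p : proj_point p -> p 0.
Proof. by case=> [[[h _ _] _] _ _]; apply: set_mem. Qed.

Lemma proj_point_mul p f g : proj_point p -> p f -> p (g * f).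
Proof.
move=> pp pf; move: (pp) => [[[h0 _ h] _] _ _]; apply: set_mem.
by move: (h g f 0 (mem_set pf) h0); rewrite addr0.
Qed.

Lemma proj_point_scale p c f : proj_point p -> p f -> p (c *: f).
Proof. by move=> pp pf; rewrite -mul_mpolyC; apply: proj_point_mul. Qed.

Lemma proj_point_sub p f g : proj_point p -> p f -> p g -> p (f - g).
Proof.
move=> pp pf pg; apply: proj_point_add => //.
by rewrite -mulN1r; apply: proj_point_mul.
Qed.

Lemma proj_point_sum p (I : Type) (r : seq I) (P : pred I) F :
  proj_point p -> (forall i, P i -> p (F i)) -> p (\sum_(i <- r | P i) F i).
Proof.
move=> pp h; apply: (big_ind p) => //; first exact: proj_point0.
by move=> *; apply: proj_point_add.
Qed.

Lemma proj_point_prime p f g : proj_point p -> p (f * g) -> p f \/ p g.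
Proof.
case=> _ h _ pfg; case/orP: (h f g (mem_set pfg)) => /set_mem; by [left | right].
Qed.

Lemma proj_point_exp p f n : proj_point p -> p (f ^+ n) -> p f.
Proof.
move=> pp; elim: n => [|n IHn].
  (* Exponent 0 puts 1 in [p], against properness. *)
  by case: pp => [[[_ /negP h _] _] _ _]; rewrite expr0 => /mem_set /h.
by rewrite exprS => /(proj_point_prime pp) [|/IHn].
Qed.

Lemma proj_point_scalar p c f : proj_point p -> c != 0 -> p (c *: f) -> p f.
Proof.
move=> pp c0 /(proj_point_scale c^-1 pp).
by rewrite scalerA mulVf // scale1r.
Qed.

Lemma proj_point_const p (c : rat) : proj_point p -> p c%:MP -> c = 0.
Proof.
move=> pp pc; apply: contrapT => /eqP c0; case: (pp) => [[[_ /negP h _] _] _ _].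
apply/h/mem_set; apply: (proj_point_scalar pp c0).
by rewrite -mul_mpolyC mulr1.
Qed.

(** * Triples of distinct coordinates *)

(** Three distinct indices exhaust ['I_3], so sums and products over the coordinates expand in
    whatever order a configuration of lines calls for; [uniq [:: i; j; k]] acts as a choice of
    labelling. *)
Lemma big_I3 (T : Type) (idx : T) (op : Monoid.com_law idx) (i j k : 'I_3)
    (F : 'I_3 -> T) :
  uniq [:: i; j; k] -> \big[op/idx]_(l < 3) F l = op (op (F i) (F j)) (F k).
Proof.
move=> u; rewrite -Monoid.mulmA.
have e : perm_eq (index_enum 'I_3) [:: i; j; k].
  apply: uniq_perm => //; first exact: index_enum_uniq.
  have sz : (size (index_enum 'I_3) <= 3)%N by rewrite -[index_enum _]enumT size_enum_ord.
  by move=> x; case: (uniq_min_size u (fun x _ => mem_index_enum x) sz) => _ ->.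
by rewrite (perm_big _ e) /= !big_cons big_nil Monoid.mulm1.
Qed.

Lemma I3_cases (i j k l : 'I_3) : uniq [:: i; j; k] -> [|| l == i, l == j | l == k].
Proof.
move=> u; move: (big_I3 orb (fun m => l == m) u) => /=; rewrite -orbA => <-.
by rewrite big_has; apply/hasP; exists l => //; rewrite mem_index_enum.
Qed.

Lemma uniq3_swap (i j k : 'I_3) : uniq [:: i; j; k] -> uniq [:: i; k; j].
Proof. by rewrite /= !inE !negb_or !andbT (eq_sym k j) => /andP [/andP [-> ->] ->]. Qed.

Lemma uniq3_rot (i j k : 'I_3) : uniq [:: i; j; k] -> uniq [:: j; k; i].
Proof. by rewrite -(rot_uniq 1). Qed.

Lemma uniq3_ex (i : 'I_3) : exists j k, uniq [:: i; j; k].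
Proof. by exists (i + 1), (i + 2); case: i => -[|[|[|//]]]. Qed.

(** * Points on a coordinate line cut out by a monic quadratic *)

Lemma proj_point_notin p (i j k : 'I_3) :
  uniq [:: i; j; k] -> proj_point p -> p 'X_i -> p 'X_j -> ~ p 'X_k.
Proof.
move=> u pp pi pj pk; case: (pp) => _ _ [l /negP]; apply; apply: mem_set.
by case/or3P: (I3_cases l u) => /eqP ->.
Qed.

(* The nonzero coefficient of [x_j ^ 2] makes [x_k] invertible at these points,
   whatever [b] and [c] are. *)
Definition line_points (i j k : 'I_3) (b c : rat) : set (set {mpoly rat[3]}) :=
  [set p | [/\ proj_point p, p 'X_i
    & p ('X_j ^+ 2 - (b *: ('X_j * 'X_k) + c *: 'X_k ^+ 2))] ]%classic.

(** Modulo [p] the square of ['X_j] is a multiple of ['X_k], so ['X_k] in [p] would put all three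
    coordinates in [p]. *)
Lemma line_points_notin i j k b c p :
  uniq [:: i; j; k] -> line_points i j k b c p -> ~ p 'X_k.
Proof.
move=> u [pp pi pq] pk; apply: (proj_point_notin u pp pi _ pk).
apply: (@proj_point_exp p 'X_j 2 pp).
rewrite -[_ ^+ 2](subrK (b *: ('X_j * 'X_k) + c *: 'X_k ^+ 2)).
apply: proj_point_add => //; apply: proj_point_add => //; apply: proj_point_scale => //.
  exact: proj_point_mul.
by rewrite expr2; apply: proj_point_mul.
Qed.

(* The remainder does not depend on [p], so that a point of [line_points] is
   determined by the linear forms it contains. *)
Definition linear_remainder i j k b c d (f : {mpoly rat[3]}) : Prop :=
  exists s t : rat, forall p, line_points i j k b c p ->
    p (f - (s *: 'X_j + t *: 'X_k) * 'X_k ^+ d).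

Lemma linear_remainder_lin i j k b c d a f g :
  linear_remainder i j k b c d f -> linear_remainder i j k b c d g ->
  linear_remainder i j k b c d (a *: f + g).
Proof.
move=> [s [t h]] [s' [t' h']]; exists (a * s + s'), (a * t + t') => p lp.
have [pp _ _] := lp.
have := proj_point_add pp (proj_point_scale a pp (h p lp)) (h' p lp).
congr (p _); rewrite -!mul_mpolyC; ring.
Qed.

(** The relation [x_j^2 = b x_j x_k + c x_k^2] is a recurrence of order two in the exponent of
    [x_j]; remainders propagate from the exponents 0 and 1, where the linear forms are [x_k] and
    [x_j]. *)
Lemma linear_remainder_XX i j k b c d m :
  (m <= d.+1)%N -> linear_remainder i j k b c d ('X_j ^+ m * 'X_k ^+ (d.+1 - m)).
Proof.
elim/ltn_ind: m d => -[|[|m]] IHm d md.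
- exists 0, 1 => p [pp _ _]; rewrite [X in p X](_ : _ = 0); first exact: proj_point0.
  by rewrite scale0r scale1r subn0 exprS; ring.
- exists 1, 0 => p [pp _ _]; rewrite [X in p X](_ : _ = 0); first exact: proj_point0.
  by rewrite scale0r scale1r subn1 /=; ring.
have [|s [t h]] := IHm m.+1 (ltnSn _) d; first lia.
have [|s' [t' h']] := IHm m (leqnSn _) d; first lia.
exists (b * s + c * s'), (b * t + c * t') => p lp; have [pp _ pq] := lp.
have := proj_point_add pp (proj_point_mul ('X_j ^+ m * 'X_k ^+ (d.+1 - m.+2)) pp pq)
  (proj_point_add pp (proj_point_scale b pp (h p lp)) (proj_point_scale c pp (h' p lp))).
have -> : (d.+1 - m.+1 = (d.+1 - m.+2).+1)%N by lia.
have -> : (d.+1 - m = (d.+1 - m.+2).+2)%N by lia.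
move: (d.+1 - m.+2)%N => e.
congr (p _); rewrite -!mul_mpolyC !exprS; ring.
Qed.

(** Monomials divisible by ['X_i] have remainder zero, the others involve only ['X_j] and ['X_k],
    and remainders add up. *)
Lemma linear_remainder_dhomog i j k b c d f : uniq [:: i; j; k] ->
  f \is d.+1.-homog -> linear_remainder i j k b c d f.
Proof.
move=> u /dhomogP hf; rewrite [f]mpolyE big_seq.
apply: big_ind.
- exists 0, 0 => p [pp _ _]; rewrite [X in p X](_ : _ = 0); first exact: proj_point0.
  by rewrite !scale0r; ring.
- by move=> g h hg hh; rewrite -[g]scale1r; apply: linear_remainder_lin.
move=> m mf; rewrite -[X in linear_remainder _ _ _ _ _ _ X]addr0.
apply: linear_remainder_lin; last first.
  exists 0, 0 => p [pp _ _]; rewrite [X in p X](_ : _ = 0); first exact: proj_point0.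
  by rewrite !scale0r; ring.
have := hf m mf; rewrite /= mdegE (mpolyXE _ 1%g) (big_I3 _ _ u).
under eq_bigr do rewrite perm1.
rewrite (big_I3 _ _ u) /=.
case: (m i) => [|mi] e.
  rewrite expr0 mul1r; have -> : m k = (d.+1 - m j)%N by lia.
  by apply: linear_remainder_XX; lia.
exists 0, 0 => p [pp pi _]; rewrite !scale0r addr0 mul0r subr0.
rewrite [X in p X](_ : _ = ('X_i ^+ mi * 'X_j ^+ m j * 'X_k ^+ m k) * 'X_i).
  exact: proj_point_mul.
by rewrite exprS; ring.
Qed.

(** A component of positive degree in [p] is, modulo both points, the same linear form times a power
    of ['X_k]. Since ['X_k] is outside [p], primeness puts that form in [p], hence in [p']. A
    component of degree 0 in [p] is zero by properness. *)
Lemma line_points_sub i j k b c p p' : uniq [:: i; j; k] ->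
  line_points i j k b c p -> line_points i j k b c p' ->
  (forall s t, p (s *: 'X_j + t *: 'X_k) -> p' (s *: 'X_j + t *: 'X_k)) ->
  (p `<=` p')%classic.
Proof.
move=> u lp lp' h f pf; have [pp _ _] := lp; have [pp' _ _] := lp'.
rewrite (@pihomog_partitionE _ _ mdeg (mmeasure mdeg f) f) //.
apply: proj_point_sum => // -[d _] _ /=.
have : p (pihomog mdeg d f).
  by case: pp => [[_ hh] _ _]; apply/set_mem/hh/mem_set.
have : pihomog mdeg d f \is d.-homog by apply: pihomogP.
move: (pihomog mdeg d f) => {pf}f; case: d => [|d] hf pf.
  have fE : f = (f@_0)%:MP.
    apply/mpolyP => m; rewrite mcoeffC; have [->|m0] := eqVneq m 0%MM.
      by rewrite mulr1.
    by rewrite mulr0 (dhomog_nemf_coeff hf) //= mdeg_eq0.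
  move: pf; rewrite fE => /(proj_point_const pp) ->.
  by rewrite mpolyC0; apply: proj_point0.
have [s [t hst]] := linear_remainder_dhomog b c u hf.
have : p ((s *: 'X_j + t *: 'X_k) * 'X_k ^+ d).
  by have := proj_point_sub pp pf (hst p lp); rewrite opprB addrC subrK.
case/(proj_point_prime pp) => [/h p'l|/(proj_point_exp pp) /(line_points_notin u lp)] //.
rewrite -(subrK ((s *: 'X_j + t *: 'X_k) * 'X_k ^+ d) f).
apply: proj_point_add => //; first exact: hst.
by rewrite mulrC; apply: proj_point_mul.
Qed.

(** Dividing the quadratic by ['X_j - r *: 'X_k] leaves the remainder [(r^2 - b r - c) x_k^2], and
    ['X_k] is outside [p]. *)
Lemma line_points_root i j k b c p r : uniq [:: i; j; k] ->
  line_points i j k b c p -> p ('X_j - r *: 'X_k) -> r ^+ 2 - (b * r + c) = 0.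
Proof.
move=> u lp pl; have [pp pi pq] := lp; apply: contrapT => /eqP r0.
apply: (line_points_notin u lp); apply: (@proj_point_exp p _ 2 pp).
apply: (proj_point_scalar pp r0).
have := proj_point_sub pp pq (proj_point_mul ('X_j + r *: 'X_k - b *: 'X_k) pp pl).
congr (p _); rewrite -!mul_mpolyC; ring.
Qed.

(** Modulo [x_j - r x_k] a form [s x_j + t x_k] becomes [(t + s r) x_k]; so the linear forms in
    [x_j] and [x_k] at such a point are exactly the multiples of [x_j - r x_k]. *)
Lemma line_points_inj i j k b c r p p' : uniq [:: i; j; k] ->
  line_points i j k b c p -> p ('X_j - r *: 'X_k) ->
  line_points i j k b c p' -> p' ('X_j - r *: 'X_k) -> p = p'.
Proof.
move=> u.
have sub p1 p2 : line_points i j k b c p1 -> p1 ('X_j - r *: 'X_k) ->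
    line_points i j k b c p2 -> p2 ('X_j - r *: 'X_k) -> (p1 `<=` p2)%classic.
  move=> lp pl lp' pl'; apply: (line_points_sub u lp lp') => s t pst.
  have [pp _ _] := lp; have [pp' _ _] := lp'.
  have ts : t + s * r = 0.
    apply: contrapT => /eqP ts; apply: (line_points_notin u lp).
    apply: (proj_point_scalar pp ts).
    have := proj_point_sub pp pst (proj_point_scale s pp pl).
    congr (p1 _); rewrite -!mul_mpolyC; ring.
  have := proj_point_scale s pp' pl'.
  congr (p2 _); rewrite -!mul_mpolyC (_ : t = - (s * r)); last by rewrite -[RHS]add0r -ts addrK.
  ring.
by move=> *; apply/seteqP; split; apply: sub.
Qed.

(** This is the case of a conjugate pair of points. A nonzero linear form [s x_j + t x_k] in the
    prime would be proportional to some [x_j - r x_k] or to [x_k], both excluded, so only zero has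
    to be compared. *)
Lemma line_points_rootless_inj i j k b c p p' : uniq [:: i; j; k] ->
  line_points i j k b c p -> (forall r, ~ p ('X_j - r *: 'X_k)) ->
  line_points i j k b c p' -> (forall r, ~ p' ('X_j - r *: 'X_k)) -> p = p'.
Proof.
move=> u.
have sub p1 p2 : line_points i j k b c p1 -> (forall r, ~ p1 ('X_j - r *: 'X_k)) ->
    line_points i j k b c p2 -> (p1 `<=` p2)%classic.
  move=> lp pl lp'; apply: (line_points_sub u lp lp') => s t pst.
  have [pp _ _] := lp; have [pp' _ _] := lp'.
  have s0 : s = 0.
    apply: contrapT => /eqP s0; apply: (pl (- (t / s))).
    apply: (proj_point_scalar pp s0); move: pst; congr (p1 _).
    rewrite scalerBr scaleNr scalerN opprK scalerA mulrCA divff // mulr1 //.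
  have t0 : t = 0.
    apply: contrapT => /eqP t0; apply: (line_points_notin u lp).
    by apply: (proj_point_scalar pp t0); move: pst; rewrite s0 scale0r add0r.
  by rewrite s0 t0 !scale0r addr0; apply: proj_point0.
by move=> *; apply/seteqP; split; apply: sub.
Qed.

Lemma finite_subsingleton (T : Type) (A : set T) :
  (forall x y, A x -> A y -> x = y) -> finite_set A.
Proof.
move=> h; have [[x Ax]|nA] := pselect (exists x, A x).
  by apply: (sub_finite_set _ (finite_set1 x)) => y Ay; apply: h.
by apply: (sub_finite_set _ (@finite_set0 T)) => y Ay; apply: nA; exists y.
Qed.

(** At most one point contains no form [x_j - r x_k], and each [r] accounts for at most one point.
    By Vieta, a root [r0] leaves [b - r0] as the only other candidate. *)
Lemma line_points_finite i j k b c : uniq [:: i; j; k] ->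
  finite_set (line_points i j k b c).
Proof.
move=> u.
pose A r := [set p | line_points i j k b c p /\ p ('X_j - r *: 'X_k)]%classic.
pose N := [set p | line_points i j k b c p /\ forall r, ~ p ('X_j - r *: 'X_k)]%classic.
have fA r : finite_set (A r).
  by apply: finite_subsingleton => p p' [? ?] [? ?]; apply: line_points_inj; eauto.
have fN : finite_set N.
  apply: finite_subsingleton => p p' [? ?] [? ?].
  exact: (line_points_rootless_inj (b := b) (c := c) u).
have [[r0 [p0 [lp0 pr0]]]|none] := pselect (exists r, exists p, A r p).
  apply: (@sub_finite_set _ _ (N `|` (A r0 `|` A (b - r0)))%classic); last first.
    by rewrite !finite_setU.
  move=> p lp; have [[r pr]|nr] := pselect (exists r, p ('X_j - r *: 'X_k)); last first.
    by left; split => // r pr; apply: nr; exists r.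
  right; have e := line_points_root u lp pr; have e0 := line_points_root u lp0 pr0.
  have /eqP : (r - r0) * (r - (b - r0)) = 0 by rewrite -[RHS]subr0 -{1}e -e0; ring.
  by rewrite mulf_eq0 !subr_eq0 => /orP [/eqP <-|/eqP <-]; [left|right].
apply: sub_finite_set fN => p lp; split => // r pr.
by apply: none; exists r, p.
Qed.

(** A vertex is the double root [r = 0] of the quadratic [x_j^2], that is, the case [b = c = 0]. *)
Lemma proj_point_vertex_inj (i j k : 'I_3) p p' : uniq [:: i; j; k] ->
  proj_point p -> p 'X_i -> p 'X_j -> proj_point p' -> p' 'X_i -> p' 'X_j -> p = p'.
Proof.
move=> u pp pi pj pp' pi' pj'.
have pt p1 : proj_point p1 -> p1 'X_i -> p1 'X_j ->
    line_points i j k 0 0 p1 /\ p1 ('X_j - 0 *: 'X_k).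
  move=> h1 h2 h3; split; last by rewrite scale0r subr0.
  by split=> //; rewrite !scale0r addr0 subr0 expr2; apply: proj_point_mul.
by have [? ?] := pt p pp pi pj; have [? ?] := pt p' pp' pi' pj'; apply: line_points_inj; eauto.
Qed.

(** * Homogeneous primes of geometric points *)

(* Restriction to the affine line through [P], that is [f |-> f (T P)]: being the
   kernel of a ring morphism to a domain makes the homogeneous ideal of a
   geometric point prime. *)
Definition point_eval (P : 'I_3 -> algC) : {mpoly rat[3]} -> {poly algC} :=
  mmap (polyC \o ratr) (fun i => P i *: 'X).

Definition point_ideal (P : 'I_3 -> algC) : set {mpoly rat[3]} :=
  [set f | point_eval P f = 0]%classic.

Lemma point_evalE P d f : f \is d.-homog ->
  point_eval P f = (map_mpoly ratr f).@[P] *: 'X^d.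
Proof.
move=> /dhomogP hf; rewrite /point_eval /mmap /map_mpoly /mmap raddf_sum scaler_suml.
rewrite !big_seq; apply: eq_bigr => m /hf /= md.
rewrite mul_polyC mevalM mevalC mmap1_id mevalX; move: (ratr _) => a.
rewrite -scalerA; congr (a *: _).
rewrite /mmap1 (eq_bigr (fun l => (P l ^+ m l) *: 'X^(m l))) => [|l _]; last exact: exprZn.
by rewrite scaler_prod -md mdegE -prodrXr.
Qed.

HB.instance Definition _ P := GRing.RMorphism.copy (point_eval P)
  (mmap (polyC \o ratr) (fun i => P i *: 'X)).

Lemma point_ideal_dhomog P d f : f \is d.-homog ->
  point_ideal P f <-> (map_mpoly ratr f).@[P] = 0.
Proof.
move=> hf; rewrite /point_ideal /= (point_evalE P hf); split=> [|->]; last by rewrite scale0r.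
by move/eqP; rewrite scaler_eq0 (negPf (monic_neq0 (monicXn _ _))) orbF => /eqP.
Qed.

Lemma point_idealX P i : point_ideal P 'X_i <-> P i = 0.
Proof.
have hX : ('X_i : {mpoly rat[3]}) \is 1.-homog by rewrite dhomogX /= mdeg1.
by have := point_ideal_dhomog P hX; rewrite map_mpolyX mevalXU.
Qed.

Lemma proj_point_point_ideal P : (exists i, P i != 0) -> proj_point (point_ideal P).
Proof.
move=> [i Pi]; split.
- split.
    split; first by apply/mem_set; rewrite /point_ideal /= rmorph0.
      by apply/negP => /set_mem; rewrite /point_ideal /= rmorph1 => /eqP; rewrite oner_eq0.
    move=> a f g /set_mem hf /set_mem hg; apply/mem_set; move: hf hg.
    by rewrite /point_ideal /= rmorphD rmorphM /= => -> ->; rewrite mulr0 addr0.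
  move=> f d /set_mem fP; apply/mem_set.
  apply/(point_ideal_dhomog _ (pihomogP _ _ _)).
  (* The degree bound is raised above [d], so that the decomposition has a summand of index [d] even
     when [d] exceeds the degree of [f]. *)
  have le : (mmeasure mdeg f <= maxn (mmeasure mdeg f) d.+1)%N by rewrite leq_maxl.
  have dK : (d < maxn (mmeasure mdeg f) d.+1)%N by rewrite leq_maxr.
  move: fP; rewrite /point_ideal /= {1}(pihomog_partitionE le) rmorph_sum /=.
  under eq_bigr do rewrite (point_evalE _ (pihomogP _ _ _)).
  (* The component of degree [e] contributes a multiple of [T^e], so the coefficient of [T^d]
     isolates the component of degree [d]. *)
  move/(congr1 (fun h : {poly algC} => h`_d)); rewrite coef_sum coef0.
  rewrite (bigD1 (Ordinal dK)) //= big1 => [|e ne].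
    by rewrite coefZ coefXn eqxx mulr1 addr0.
  rewrite coefZ coefXn; case: eqVneq => [de|]; last by rewrite mulr0.
  by case/eqP: ne; apply: val_inj.
- move=> f g /set_mem; rewrite /point_ideal /= rmorphM /= => /eqP.
  by rewrite mulf_eq0 => /orP [] /eqP h; apply/orP; [left|right]; apply/mem_set.
- by exists i; apply/negP => /set_mem /point_idealX /eqP; apply/negP.
Qed.

(** * Coefficients of the quadratic form and smoothness *)

(** Off the diagonal this is the whole coefficient of [x_i x_j], not half of it as in a Gram matrix;
    hence the factor 2 on diagonal terms only in the derivatives. *)
Definition form_coef (q : {mpoly rat[3]}) (i j : 'I_3) : rat := q@_(U_(i) + U_(j)).

Lemma form_coefC q i j : form_coef q i j = form_coef q j i.
Proof. by rewrite /form_coef addmC. Qed.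

Lemma quadratic_formE q (i j k : 'I_3) : uniq [:: i; j; k] -> q \is 2.-homog ->
  q = form_coef q i i *: 'X_i ^+ 2 + form_coef q j j *: 'X_j ^+ 2
    + form_coef q k k *: 'X_k ^+ 2 + form_coef q i j *: ('X_i * 'X_j)
    + form_coef q i k *: ('X_i * 'X_k) + form_coef q j k *: ('X_j * 'X_k).
Proof.
move=> u hq.
have eqm (m m' : 'X_{1..3}) : (m == m') = [&& m i == m' i, m j == m' j & m k == m' k].
  apply/eqP/and3P => [->//|[/eqP ei /eqP ej /eqP ek]]; apply/mnmP => l.
  by case/or3P: (I3_cases l u) => /eqP ->.
move: (u); rewrite /= !inE negb_or andbT => /andP [/andP [ij ik] jk].
have ineq := (negPf ij, negPf ik, negPf jk, eq_sym j i, eq_sym k i, eq_sym k j).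
apply/mpolyP => m; rewrite !expr2 -!mpolyXD !mcoeffD !mcoeffZ !mcoeffX.
have [md|md] := eqVneq (mdeg m) 2%N; last first.
  rewrite (dhomog_nemf_coeff hq md); have z a b : (U_(a) + U_(b) == m)%MM = false.
    by apply: contraNF md => /eqP <-; rewrite mdegD !mdeg1.
  by rewrite !z !mulr0 !addr0.
rewrite !eqm !mnmDE !mnm1E !eqxx !ineq /form_coef.
have mE a b : (U_(a) + U_(b))%MM i = m i -> (U_(a) + U_(b))%MM j = m j ->
   (U_(a) + U_(b))%MM k = m k -> q@_m = q@_(U_(a) + U_(b)).
  by move=> ei ej ek; congr mcoeff; apply/eqP; rewrite eq_sym eqm ei ej ek !eqxx.
move: md; rewrite mdegE (big_I3 _ _ u) /=.
move: (mE i i) (mE j j) (mE k k) (mE i j) (mE i k) (mE j k).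
rewrite !mnmDE !mnm1E !eqxx !ineq /=.
(* Total degree 2 leaves six exponent vectors, one for each hypothesis [h1] to [h6]. *)
case: (m i) => [|[|[|?]]]; case: (m j) => [|[|[|?]]]; case: (m k) => [|[|[|?]]] //=;
  move=> h1 h2 h3 h4 h5 h6 _; rewrite ?(mulr0, mulr1, addr0, add0r);
  by [apply: h1|apply: h2|apply: h3|apply: h4|apply: h5|apply: h6].
Qed.

Lemma quadratic_form_mderiv q (i j k : 'I_3) (P : 'I_3 -> rat) :
  uniq [:: i; j; k] -> q \is 2.-homog ->
  (mderiv i q).@[P] =
    2 * form_coef q i i * P i + form_coef q i j * P j + form_coef q i k * P k.
Proof.
move=> u hq; rewrite {1}(quadratic_formE u hq).
have dX l m : mderiv l ('X_m : {mpoly rat[3]}) = (l == m)%:R%:MP.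
  rewrite mderivX mnm1E; case: eqVneq => [->|_]; last by rewrite scale0r mpolyC0.
  have -> : (U_(l) - U_(l) = 0)%MM by apply/mnmP => x; rewrite mnmBE mnm0E subnn.
  by rewrite mpolyX0 scale1r.
move: (u); rewrite /= !inE negb_or andbT => /andP [/andP [ij ik] jk].
rewrite !expr2 !mderivD !mderivZ !mderivM !dX eqxx (negPf ij) (negPf ik).
rewrite !mpolyC0 mpolyC1 !mevalD !mevalZ !mevalD !mevalM !meval0 !meval1 !mevalXU.
ring.
Qed.

Lemma map_mpoly_ratr_eval f (P : 'I_3 -> rat) :
  (map_mpoly ratr f).@[fun i => ratr (P i) : algC] = ratr f.@[P].
Proof.
elim/mpolyind: f => [|c m f _ _ IHf]; first by rewrite !raddf0.
rewrite raddfD /= !mevalD rmorphD /= IHf; congr (_ + _).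
rewrite map_mpolyZ map_mpolyX !mevalZ !mevalX rmorphM rmorph_prod; congr (_ * _).
by apply: eq_bigr => i _; rewrite rmorphXn.
Qed.

(** A nonzero rational vector killed by all partial derivatives is a singular point of the curve. *)
Lemma smooth_quadratic_form q (i j k : 'I_3) (P : 'I_3 -> rat) :
  uniq [:: i; j; k] -> q \is 2.-homog -> smooth_curve q -> (exists l, P l != 0) ->
  [/\ 2 * form_coef q i i * P i + form_coef q i j * P j + form_coef q i k * P k = 0,
      2 * form_coef q j j * P j + form_coef q i j * P i + form_coef q j k * P k = 0 &
      2 * form_coef q k k * P k + form_coef q i k * P i + form_coef q j k * P j = 0] ->
  False.
Proof.
move=> u hq sm [l Pl] [ei ej ek].
have uj := uniq3_rot (uniq3_rot (uniq3_swap u)); have uk := uniq3_rot (uniq3_rot u).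
have d m : (mderiv m q).@[P] = 0.
  case/or3P: (I3_cases m u) => /eqP ->.
  - by rewrite (quadratic_form_mderiv _ u hq).
  - by rewrite (quadratic_form_mderiv _ uj hq) (form_coefC q j i).
  - by rewrite (quadratic_form_mderiv _ uk hq) (form_coefC q k i) (form_coefC q k j).
have qP : q.@[P] = 0.
  (* Euler's identity for a form of degree 2. *)
  apply: (@mulfI _ 2) => //; rewrite mulr0 (quadratic_formE u hq).
  rewrite !mevalD !mevalZ !mevalM.
  transitivity (P i * (2 * form_coef q i i * P i + form_coef q i j * P j + form_coef q i k * P k)
    + P j * (2 * form_coef q j j * P j + form_coef q i j * P i + form_coef q j k * P k)
    + P k * (2 * form_coef q k k * P k + form_coef q i k * P i + form_coef q j k * P j)).
    by rewrite !mevalXU; ring.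
  by rewrite ei ej ek !mulr0 !addr0.
case: (sm (fun i => ratr (P i))) => [||m].
- by exists l; rewrite fmorph_eq0.
- by rewrite map_mpoly_ratr_eval qP rmorph0.
- by rewrite map_mpoly_ratr_eval d rmorph0 eqxx.
Qed.

(** Otherwise [x_i] divides the form, and the conic is singular where the line [x_i = 0] meets the
    residual line. *)
Lemma quadratic_form_side_neq0 q (i j k : 'I_3) :
  uniq [:: i; j; k] -> q \is 2.-homog -> smooth_curve q ->
  form_coef q j j = 0 -> form_coef q k k = 0 -> form_coef q j k != 0.
Proof.
move=> u hq sm ajj akk; apply/eqP => ajk.
move: (u); rewrite /= !inE !negb_or andbT => /andP [/andP [ij ik] jk].
(* If [a_ij = a_ik = 0] the form is [a_ii x_i^2] and [e_j] is singular; otherwise the residual line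
   meets [x_i = 0] at the point with [x_j = a_ik] and [x_k = - a_ij]. *)
have [/andP [/eqP aij /eqP aik]|ne0] := boolP ((form_coef q i j == 0) && (form_coef q i k == 0)).
  apply: (smooth_quadratic_form (P := fun l => (l == j)%:R) u hq sm).
    by exists j; rewrite eqxx oner_eq0.
  by rewrite eqxx (negPf ij) (eq_sym k) (negPf jk) ajj akk aij aik ajk /=; split; ring.
pose P l := if l == j then form_coef q i k else if l == k then - form_coef q i j else 0.
have Pi : P i = 0 by rewrite /P (negPf ij) (negPf ik).
have Pj : P j = form_coef q i k by rewrite /P eqxx.
have Pk : P k = - form_coef q i j by rewrite /P eqxx (eq_sym k) (negPf jk).
apply: (smooth_quadratic_form (P := P) u hq sm).
  move: ne0; rewrite negb_and => /orP [aij|aik].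
    by exists k; rewrite Pk oppr_eq0.
  by exists j; rewrite Pj.
by rewrite Pi Pj Pk ajj akk ajk; split; ring.
Qed.

(** The partial derivatives at the vertex [e_k] are [a_ik], [a_jk] and [2 a_kk]. *)
Lemma quadratic_form_tangent_neq0 q (i j k : 'I_3) :
  uniq [:: i; j; k] -> q \is 2.-homog -> smooth_curve q ->
  form_coef q k k = 0 -> (form_coef q i k != 0) || (form_coef q j k != 0).
Proof.
move=> u hq sm akk; rewrite -negb_and; apply/negP => /andP [/eqP aik /eqP ajk].
move: (u); rewrite /= !inE !negb_or andbT => /andP [/andP [ij ik] jk].
apply: (smooth_quadratic_form (P := fun l => (l == k)%:R) u hq sm).
  by exists k; rewrite eqxx oner_eq0.
by rewrite eqxx (negPf ik) (negPf jk) akk aik ajk /=; split; ring.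
Qed.

(** * The divisor cut out by a coordinate line *)

Lemma divisor_points_side q (i j k : 'I_3) p :
  uniq [:: i; j; k] -> q \is 2.-homog -> divisor_points q i p ->
  p (form_coef q j j *: 'X_j ^+ 2 + form_coef q j k *: ('X_j * 'X_k)
     + form_coef q k k *: 'X_k ^+ 2).
Proof.
move=> u hq [pp /set_mem pq /set_mem pi].
have := proj_point_sub pp pq (proj_point_mul
  (form_coef q i i *: 'X_i + form_coef q i j *: 'X_j + form_coef q i k *: 'X_k) pp pi).
rewrite {1}(quadratic_formE u hq); congr (p _).
have side_eq (A : comPzRingType) (a b c d e f x y z : A) :
    a * x ^+ 2 + b * y ^+ 2 + c * z ^+ 2 + d * (x * y) + e * (x * z) + f * (y * z)
      - (a * x + d * y + e * z) * x = b * y ^+ 2 + f * (y * z) + c * z ^+ 2 by ring.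
rewrite -!mul_mpolyC.
by rewrite side_eq.
Qed.

Lemma divisor_points_line q (i j k : 'I_3) :
  uniq [:: i; j; k] -> q \is 2.-homog -> form_coef q j j != 0 ->
  (divisor_points q i `<=` line_points i j k (- (form_coef q j k / form_coef q j j))
     (- (form_coef q k k / form_coef q j j)))%classic.
Proof.
move=> u hq ajj p dp; have [pp _ /set_mem pi] := dp; split=> //.
have := proj_point_scale (form_coef q j j)^-1 pp (divisor_points_side u hq dp).
congr (p _); rewrite !scalerDr !scalerA mulVf // scale1r.
by rewrite !scaleNr opprD !opprK addrA ![_^-1 * _]mulrC.
Qed.

Lemma divisor_points_vertices q (i j k : 'I_3) p :
  uniq [:: i; j; k] -> q \is 2.-homog -> smooth_curve q ->
  form_coef q j j = 0 -> form_coef q k k = 0 ->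
  divisor_points q i p -> p 'X_j \/ p 'X_k.
Proof.
move=> u hq sm ajj akk dp; have [pp _ _] := dp.
have := divisor_points_side u hq dp.
rewrite ajj akk !scale0r add0r addr0.
move/(proj_point_scalar pp (quadratic_form_side_neq0 u hq sm ajj akk)).
exact: proj_point_prime.
Qed.

(** If [p] contains a form [x_j - r x_k], so does [p']. If [p] contains none, neither does [p']: a
    root [r] would split the quadratic as [(x_j - r x_k)(x_j - (b - r) x_k)], and primeness would
    put a factor in [p]. *)
Lemma line_points_antichain i j k b c p p' : uniq [:: i; j; k] ->
  line_points i j k b c p -> line_points i j k b c p' -> (p `<=` p')%classic -> p = p'.
Proof.
move=> u lp lp' sub.
have [[r pr]|np] := pselect (exists r, p ('X_j - r *: 'X_k)).
  by apply: (line_points_inj u lp pr lp'); apply: sub.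
have nr r : ~ p ('X_j - r *: 'X_k) by move=> pr; apply: np; exists r.
apply: (line_points_rootless_inj u lp nr lp') => r pr'.
have [pp _ pq] := lp; have e := line_points_root u lp' pr'.
case: (@proj_point_prime p ('X_j - r *: 'X_k) ('X_j - (b - r) *: 'X_k) pp); try exact: nr.
move: pq; congr (p _); rewrite (_ : c = r ^+ 2 - b * r); last by rewrite -[LHS]addr0 -e; ring.
rewrite -!mul_mpolyC; ring.
Qed.

(** The restricted form can be made monic in [x_j] or in [x_k], unless it is [a_jk x_j x_k], whose
    zeros are the two vertices on the line. *)
Lemma divisor_points_finite q i : q \is 2.-homog -> smooth_curve q ->
  finite_set (divisor_points q i).
Proof.
move=> hq sm.
have [j [k u]] := uniq3_ex i.
have [ajj|ajj] := eqVneq (form_coef q j j) 0; last first.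
  exact: sub_finite_set (divisor_points_line u hq ajj) (line_points_finite _ _ u).
have u' := uniq3_swap u.
have [akk|akk] := eqVneq (form_coef q k k) 0; last first.
  exact: sub_finite_set (divisor_points_line u' hq akk) (line_points_finite _ _ u').
have f1 (l m : 'I_3) : uniq [:: i; l; m] ->
    finite_set [set p | [/\ proj_point p, p 'X_i & p 'X_l]]%classic.
  move=> w; apply: finite_subsingleton => p p' [? ? ?] [? ? ?].
  exact: (proj_point_vertex_inj w).
apply: (@sub_finite_set _ _ ([set p | [/\ proj_point p, p 'X_i & p 'X_j]] `|`
   [set p | [/\ proj_point p, p 'X_i & p 'X_k]])%classic); last first.
  by rewrite finite_setU; split; [apply: f1 u | apply: f1 u'].
move=> p dp; have [pp _ /set_mem pi] := dp.
by case: (divisor_points_vertices u hq sm ajj akk dp) => ?; [left | right].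
Qed.

Lemma divisor_points_antichain q i p p' : q \is 2.-homog -> smooth_curve q ->
  divisor_points q i p -> divisor_points q i p' -> (p `<=` p')%classic -> p = p'.
Proof.
move=> hq sm dp dp' sub.
have [j [k u]] := uniq3_ex i.
have [ajj|ajj] := eqVneq (form_coef q j j) 0; last first.
  have line := divisor_points_line u hq ajj.
  exact: (line_points_antichain u (line p dp) (line p' dp') sub).
have u' := uniq3_swap u.
have [akk|akk] := eqVneq (form_coef q k k) 0; last first.
  have line := divisor_points_line u' hq akk.
  exact: (line_points_antichain u' (line p dp) (line p' dp') sub).
have [pp _ /set_mem pi] := dp; have [pp' _ /set_mem pi'] := dp'.
case: (divisor_points_vertices u hq sm ajj akk dp) => pv.
- by apply: (proj_point_vertex_inj u) => //; apply: sub.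
- by apply: (proj_point_vertex_inj u') => //; apply: sub.
Qed.

(** The antichain property makes each point of the divisor minimal, so components are counted as
    points. *)
Lemma divisor_componentsE q i : q \is 2.-homog -> smooth_curve q ->
  divisor_components q i = divisor_points q i.
Proof.
move=> hq sm; apply/seteqP; split=> p; first by case.
move=> dp; split=> // p' dp' sub; exact: (divisor_points_antichain hq sm dp').
Qed.

(** Points are produced geometrically: a zero of the restricted form over [algC] gives a prime over
    the rationals. *)
Lemma divisor_points_point_ideal q (P : 'I_3 -> algC) (i j k : 'I_3) :
  uniq [:: i; j; k] -> q \is 2.-homog -> (exists l, P l != 0) -> P i = 0 ->
  ratr (form_coef q j j) * P j ^+ 2 + ratr (form_coef q j k) * (P j * P k)
    + ratr (form_coef q k k) * P k ^+ 2 = 0 ->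
  divisor_points q i (point_ideal P).
Proof.
move=> u hq P0 Pi e; split; first exact: proj_point_point_ideal.
- apply/mem_set/(point_ideal_dhomog _ hq).
  rewrite {1}(quadratic_formE u hq) !expr2 !raddfD /= !map_mpolyZ !mevalZ.
  rewrite !rmorphM /= !map_mpolyX !mevalXU Pi.
  have side_eq (A : comPzRingType) (a b c d g f y z : A) :
      a * (0 * 0) + b * (y * y) + c * (z * z) + d * (0 * y) + g * (0 * z) + f * (y * z)
      = b * (y * y) + f * (y * z) + c * (z * z) by ring.
  by rewrite side_eq -!expr2.
- exact/mem_set/point_idealX.
Qed.

Lemma quadratic_root (F : numClosedFieldType) (a b c : F) : a != 0 ->
  exists y, a * y ^+ 2 + b * y + c = 0.
Proof.
move=> a0; exists ((- b + sqrtC (b ^+ 2 - 4 * a * c)) / (2 * a)).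
move: (sqrtCK (b ^+ 2 - 4 * a * c)); move: (sqrtC _) => s es.
apply: (@mulfI _ (4 * a)); first by rewrite mulf_neq0 // pnatr_eq0.
rewrite mulr0 -[RHS](subrr (s ^+ 2)) {2}es; field.
by rewrite a0.
Qed.

(** * Bounds on the numbers of common components *)

Lemma common_components_gt0 q i : q \is 2.-homog -> smooth_curve q ->
  (0 < common_components q i i)%N.
Proof.
move=> hq sm.
have [j [k u]] := uniq3_ex i.
move: (u); rewrite /= !inE !negb_or andbT => /andP [/andP [ij ik] jk].
suff [p dp] : exists p, divisor_points q i p.
  rewrite /common_components setIid divisor_componentsE // cardfs_gt0.
  apply/fset0Pn; exists p; rewrite in_fset_set ?mem_set //.
  exact: divisor_points_finite.
have [ajj|ajj] := eqVneq (form_coef q j j) 0.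
  exists (point_ideal (fun l => (l == j)%:R)).
  apply: (divisor_points_point_ideal u hq); rewrite ?(negPf ij) //.
    by exists j; rewrite eqxx oner_eq0.
  by rewrite ajj rmorph0 (eq_sym k) (negPf jk) /= expr0n !(mul0r, mulr0) !addr0.
have [|y ey] := @quadratic_root _ (ratr (form_coef q j j) : algC)
  (ratr (form_coef q j k)) (ratr (form_coef q k k)); first by rewrite fmorph_eq0.
exists (point_ideal (fun l => if l == j then y else (l == k)%:R)).
apply: (divisor_points_point_ideal u hq); rewrite ?(negPf ij) ?(negPf ik) //.
  by exists k; rewrite (eq_sym k) (negPf jk) eqxx oner_eq0.
by rewrite !eqxx (eq_sym k) (negPf jk) /= expr1n !mulr1 ey.
Qed.

Lemma common_components_gt1 q (i j k : 'I_3) :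
  uniq [:: i; j; k] -> q \is 2.-homog -> smooth_curve q ->
  form_coef q k k = 0 -> form_coef q j k != 0 -> (1 < common_components q i i)%N.
Proof.
move=> u hq sm akk ajk.
move: (u); rewrite /= !inE !negb_or andbT => /andP [/andP [ij ik] jk].
(* With [a_kk = 0] the restricted form is [x_j (a_jj x_j + a_jk x_k)]; [P] and [Q] are the zeros of
   its factors, and [x_j] separates them. *)
pose P l : algC := (l == k)%:R.
pose Q l : algC := if l == j then ratr (form_coef q j k)
  else if l == k then - ratr (form_coef q j j) else 0.
have dP : divisor_points q i (point_ideal P).
  apply: (divisor_points_point_ideal u hq); rewrite /P ?(negPf ik) //.
    by exists k; rewrite eqxx oner_eq0.
  by rewrite akk rmorph0 (negPf jk) /= expr0n !(mul0r, mulr0) !addr0.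
have Qj : Q j != 0 by rewrite /Q eqxx fmorph_eq0.
have dQ : divisor_points q i (point_ideal Q).
  apply: (divisor_points_point_ideal u hq); first by exists j.
    by rewrite /Q (negPf ij) (negPf ik).
  have root_eq (A : comPzRingType) (a b c : A) : a * b ^+ 2 + b * (b * - a) + 0 * c = 0 by ring.
  by rewrite /Q !eqxx (eq_sym k) (negPf jk) akk rmorph0 root_eq.
have PQ : point_ideal P != point_ideal Q.
  apply/eqP => e; have : point_ideal P 'X_j by apply/point_idealX; rewrite /P (negPf jk).
  by rewrite e => /point_idealX /eqP; apply/negP.
rewrite /common_components setIid divisor_componentsE //.
apply: (@leq_trans #|` [fset point_ideal P; point_ideal Q]%fset|).
  by rewrite cardfs2 PQ.
have fin := divisor_points_finite i hq sm.
by apply/fsubset_leq_card/fsubsetP => p; rewrite !inE in_fset_set // => /orP [] /eqP ->;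
  apply/mem_set.
Qed.

Lemma common_componentsC q i j : common_components q i j = common_components q j i.
Proof. by rewrite /common_components setIC. Qed.

Lemma common_components_le1 q (i j k : 'I_3) : uniq [:: i; j; k] ->
  (common_components q i j <= 1)%N.
Proof.
move=> u; rewrite /common_components.
set A := (_ `&` _)%classic.
have sA p p' : A p -> A p' -> p = p'.
  case=> [[[pp _ /set_mem pi] _] [[_ _ /set_mem pj] _]].
  case=> [[[pp' _ /set_mem pi'] _] [[_ _ /set_mem pj'] _]].
  exact: (proj_point_vertex_inj u).
have fA := finite_subsingleton sA.
have [->|[p]] := fset_0Vmem (fset_set A); first by rewrite cardfs0.
rewrite in_fset_set // => /set_mem Ap.
apply: (@leq_trans #|` [fset p]%fset|); last by rewrite cardfs1.
apply/fsubset_leq_card/fsubsetP => p'.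
by rewrite in_fset_set // => /set_mem /(sA _ _ Ap) ->; rewrite inE.
Qed.

Lemma common_components_vertex q (i j k : 'I_3) :
  uniq [:: i; j; k] -> q \is 2.-homog ->
  (0 < common_components q i j)%N -> form_coef q k k = 0.
Proof.
move=> u hq; rewrite /common_components cardfs_gt0 => /fset0Pn [p].
set A := (_ `&` _)%classic => pA.
(* [fset_set] is empty on an infinite set, so a member forces finiteness. *)
have fA : finite_set A.
  by apply: contrapT => nA; move: pA; rewrite /fset_set; case: pselect.
move: pA; rewrite in_fset_set // => /set_mem [[dp _] [[_ _ /set_mem pj] _]].
have [pp _ /set_mem pi] := dp.
apply: contrapT => /eqP akk; apply: (proj_point_notin u pp pi pj).
apply: (@proj_point_exp p _ 2 pp); apply: (proj_point_scalar pp akk).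
have := proj_point_sub pp (divisor_points_side u hq dp) (proj_point_mul
  (form_coef q j j *: 'X_j + form_coef q j k *: 'X_k) pp pj).
congr (p _); rewrite -!mul_mpolyC; ring.
Qed.

(** * The determinant and its consequences for the counts *)

Lemma det_3 (F : comPzRingType) (M : 'M[F]_3) :
  \det M = M 0 0 * (M 1 1 * M 2 2 - M 1 2 * M 2 1)
         - M 0 1 * (M 1 0 * M 2 2 - M 1 2 * M 2 0)
         + M 0 2 * (M 1 0 * M 2 1 - M 1 1 * M 2 0).
Proof.
rewrite (expand_det_row _ 0) !big_ord_recl big_ord0 /cofactor !(expand_det_row _ 0).
rewrite !big_ord_recl !big_ord0 /cofactor !det_mx11 !mxE /=.
(* Indexing by natural numbers makes the lifted ordinals of the expansion agree with the literals 0,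
   1, 2. *)
pose f (a b : nat) := M (inord a) (inord b).
have e i j : M i j = f i j by rewrite /f !inord_val.
rewrite !e /= /bump /=; ring.
Qed.

(** The matrix is [(c_ij)] scaled on both sides by the inverse square roots of the diagonal, so
    [det (c_ij) = 0]; the negative terms are moved across to stay in [nat]. *)
Lemma component_matrix_det_eq0 (R : realType) q :
  let c := common_components q in
  (forall i, 0 < c i i)%N -> component_matrix R q \notin unitmx ->
  let n0 := c 0 0 in let n1 := c 1 1 in let n2 := c 2 2 in
  let x := c 1 2 in let y := c 2 0 in let z := c 0 1 in
  (n0 * n1 * n2 + 2 * (x * y * z) = n0 * x ^ 2 + n1 * y ^ 2 + n2 * z ^ 2)%N.
Proof.
move=> c c_gt0; rewrite unitmxE unitfE negbK det_3 !mxE => det0 n0 n1 n2 x y z; move: det0.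
rewrite (common_componentsC q 1 0) (common_componentsC q 0 2).
rewrite (common_componentsC q 2 1) -/c -/n0 -/n1 -/n2 -/x -/y -/z.
have : [/\ 0 < n0, 0 < n1 & 0 < n2]%N by split; apply: c_gt0.
move: n0 n1 n2 x y z => n0 n1 n2 x y z [n0_gt0 n1_gt0 n2_gt0].
rewrite !sqrtrM ?ler0n //.
have s_neq0 n : (0 < n)%N -> Num.sqrt (n%:R : R) != 0.
  by move=> n_gt0; rewrite sqrtr_eq0 -ltNge ltr0n.
have sE n : n%:R = Num.sqrt (n%:R : R) ^+ 2 by rewrite sqr_sqrtr // ler0n.
move: (s_neq0 _ n0_gt0) (s_neq0 _ n1_gt0) (s_neq0 _ n2_gt0) (sE n0) (sE n1) (sE n2).
move: (Num.sqrt n0%:R) (Num.sqrt n1%:R) (Num.sqrt n2%:R) => s0 s1 s2.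
move=> z0 z1 z2 e0 e1 e2 /eqP det0.
apply/eqP; rewrite -(eqr_nat R) !natrD !natrM; apply/eqP/subr0_eq.
rewrite -(mulr0 (s0 ^+ 2 * s1 ^+ 2 * s2 ^+ 2)) -det0 e0 e1 e2; field.
by rewrite z0 z1 z2.
Qed.

Lemma perm3 (i j k : 'I_3) : uniq [:: i; j; k] ->
  exists s : 'S_3, [/\ s 0 = i, s 1 = j & s 2 = k].
Proof.
move=> u; have inj : injective (tnth [tuple i; j; k]) by apply/tuple_uniqP.
by exists (perm inj); split; rewrite permE.
Qed.

(* [x], [y], [z] stand for [c_12], [c_20], [c_01], and [n_i] for [c_ii]. *)
Lemma singular_component_counts (n0 n1 n2 x y z : nat) :
  (0 < n0 -> 0 < n1 -> 0 < n2 -> x <= 1 -> y <= 1 -> z <= 1 ->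
  (0 < x -> (1 < n1) || (1 < n2)) -> (0 < y -> (1 < n2) || (1 < n0)) ->
  (0 < z -> (1 < n0) || (1 < n1)) ->
  (0 < y -> 0 < z -> 1 < n0) -> (0 < x -> 0 < z -> 1 < n1) -> (0 < x -> 0 < y -> 1 < n2) ->
  n0 * n1 * n2 + 2 * (x * y * z) = n0 * x ^ 2 + n1 * y ^ 2 + n2 * z ^ 2 ->
  [\/ [/\ 0 < y, 0 < z, n1 <= 1 & n2 <= 1], [/\ 0 < x, 0 < z, n0 <= 1 & n2 <= 1] |
      [/\ 0 < x, 0 < y, n0 <= 1 & n1 <= 1]])%N.
Proof.
move=> p0 p1 p2.
case: x => [|[|//]] _; case: y => [|[|//]] _; case: z => [|[|//]] _ => /= h1 h2 h3 h4 h5 h6;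
  rewrite ?exp0n ?exp1n ?muln0 ?mul0n ?muln1 ?addn0 ?add0n // => e.
- have : (0 < n0 * n1 * n2)%N by rewrite !muln_gt0 p0 p1.
  by rewrite e.
- have : (2 <= n0 * n1)%N by have := h3 isT; nia.
  by rewrite -(leq_pmul2r p2) e; lia.
- have : (2 <= n0 * n2)%N by have := h2 isT; nia.
  by rewrite -(leq_pmul2r p1) mulnAC e; lia.
(* Here [n0 n1 n2 = n1 + n2] with [n0 >= 2], so [2 n1 n2 <= n1 + n2], which forces [n1 = n2 = 1]. *)
- have le : (2 * (n1 * n2) <= n0 * n1 * n2)%N by rewrite -mulnA leq_mul ?h4.
  by apply: Or31; split=> //; nia.
- have : (2 <= n1 * n2)%N by have := h1 isT; nia.
  by rewrite -(leq_pmul2l p0) mulnA e; lia.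
- have le : (2 * (n0 * n2) <= n0 * n1 * n2)%N by rewrite mulnAC [leqRHS]mulnC leq_mul ?h5.
  by apply: Or32; split=> //; nia.
- have le : (2 * (n0 * n1) <= n0 * n1 * n2)%N by rewrite mulnC leq_mul ?h6.
  by apply: Or33; split=> //; nia.
(* With all [n_i >= 2], summing [4 n_i <= n0 n1 n2] contradicts [n0 n1 n2 + 2 = n0 + n1 + n2]. *)
- have g0 := h4 isT isT; have g1 := h5 isT isT; have g2 := h6 isT isT.
  have le0 : (n0 * (2 * 2) <= n0 * n1 * n2)%N by rewrite -mulnA !leq_mul.
  have le1 : (n1 * (2 * 2) <= n0 * n1 * n2)%N by rewrite [(n0 * n1)%N]mulnC -mulnA !leq_mul.
  have le2 : (2 * 2 * n2 <= n0 * n1 * n2)%N by rewrite !leq_mul.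
  lia.
Qed.

(** * The equation of the conic *)

Lemma bitangent_equation q (i j k : 'I_3) :
  uniq [:: i; j; k] -> q \is 2.-homog -> smooth_curve q ->
  (0 < common_components q i j)%N -> (0 < common_components q i k)%N ->
  (common_components q j j <= 1)%N -> (common_components q k k <= 1)%N ->
  exists (s : 'S_3) (c : rat),
    has_equation q ('X_(s 0) * 'X_(s 1) - c *: 'X_(s 2) ^+ 2).
Proof.
move=> u hq sm cij cik nj nk.
have akk := common_components_vertex u hq cij.
have ajj := common_components_vertex (uniq3_swap u) hq cik.
have aik : form_coef q i k = 0.
  apply/eqP; apply: contraTT nj; rewrite -ltnNge.
  exact: (common_components_gt1 (uniq3_rot (uniq3_rot (uniq3_swap u)))).
have aij : form_coef q i j = 0.
  apply/eqP; apply: contraTT nk; rewrite -ltnNge.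
  exact: (common_components_gt1 (uniq3_rot (uniq3_rot u))).
have ajk := quadratic_form_side_neq0 u hq sm ajj akk.
have [s [s0 s1 s2]] := perm3 (uniq3_rot u).
(* What remains is [a_ii x_i^2 + a_jk x_j x_k]; [s] sends the squared coordinate to the last
   place. *)
exists s, (- (form_coef q i i / form_coef q j k)), (form_coef q j k) => //.
rewrite s0 s1 s2 {1}(quadratic_formE u hq) ajj akk aij aik !scale0r !addr0.
by rewrite scaleNr opprK scalerDr scalerA mulrCA divff // mulr1 addrC.
Qed.

Theorem theorem1p7 (R : realType) (q : {mpoly rat[3]})
  (hq : plane_conic q) (hsmooth : smooth_curve q)
  (hpt : has_rational_point q)
  (hsing : component_matrix R q \notin unitmx) :
  exists (s : 'S_3) (c : rat),
    has_equation q ('X_(s 0) * 'X_(s 1) - c *: 'X_(s 2) ^+ 2).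
Proof.
have {}hq : q \is 2.-homog by case: hq.
have gt0 i : (0 < common_components q i i)%N by apply: common_components_gt0.
have u : uniq [:: 0; 1; 2 : 'I_3] by [].
have tangent (i j k : 'I_3) : uniq [:: i; j; k] -> (0 < common_components q i j)%N ->
    (1 < common_components q i i)%N || (1 < common_components q j j)%N.
  move=> v /(common_components_vertex v hq) akk.
  case/orP: (quadratic_form_tangent_neq0 v hq hsmooth akk) => a0; apply/orP.
    by right; apply: (common_components_gt1 (uniq3_rot (uniq3_rot (uniq3_swap v)))).
  by left; apply: (common_components_gt1 v).
(* Here the line [x_i = 0] passes through two vertices [e_j] and [e_k] of the conic. *)
have chord (i j k : 'I_3) : uniq [:: i; j; k] -> (0 < common_components q i k)%N ->
    (0 < common_components q i j)%N -> (1 < common_components q i i)%N.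
  move=> v /(common_components_vertex (uniq3_swap v) hq) ajj.
  move=> /(common_components_vertex v hq) akk.
  by apply: (common_components_gt1 v) => //; apply: quadratic_form_side_neq0 v _ _ _ _.
have e := component_matrix_det_eq0 gt0 hsing.
have := singular_component_counts (gt0 0) (gt0 1) (gt0 2)
  (common_components_le1 q (uniq3_rot u)) (common_components_le1 q (uniq3_rot (uniq3_rot u)))
  (common_components_le1 q u) (tangent _ _ _ (uniq3_rot u))
  (tangent _ _ _ (uniq3_rot (uniq3_rot u)))
  (tangent _ _ _ u) _ _ _ e.
rewrite (common_componentsC q 2 0); case.
- exact: (chord 0 1 2).
- by rewrite (common_componentsC q 0 1); apply: (chord 1 0 2).
- by rewrite (common_componentsC q 1 2) (common_componentsC q 0 2); apply: (chord 2 0 1).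
- by case=> y z n1 n2; apply: (bitangent_equation u).
- by case=> x z n0 n2; apply: (@bitangent_equation q 1 0 2) => //; rewrite common_componentsC.
- case=> x y n0 n1; apply: (@bitangent_equation q 2 0 1) => //; by rewrite common_componentsC.
Qed.
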